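(* The group $\overline{\mathbb{Z}}$ with square-norm $q$ is a Hilbert lattice and $\mathrm{P}(\overline{\mathbb{Z}})=1$.
   Context: $\overline{\mathbb{Z}}$ is the ring of algebraic integers in an algebraic closure $\overline{\mathbb{Q}}$ of $\mathbb{Q}$. The map $q:\overline{\mathbb{Q}}\to\mathbb{R}_{\geq0}$ is given by $$q(\alpha)=\frac{1}{[\mathbb{Q}(\alpha):\mathbb{Q}]}\sum_{\sigma:\mathbb{Q}(\alpha)\to\mathbb{C}}|\sigma(\alpha)|^2,$$ the sum ranging over all field embeddings of $\mathbb{Q}(\alpha)$ in $\mathbb{C}$. A Hilbert lattice is an abelian group $\Lambda$ together with a map $q:\Lambda\to\mathbb{R}$ (its square-norm) such that $q(x+y)+q(x-y)=2q(x)+2q(y)$ for all $x,y\in\Lambda$, and there exists $r\in\mathbb{R}_{>0}$ with $q(x)\geq r$ for all non-zero $x\in\Lambda$. For a Hilbert lattice, $\mathrm{P}(\Lambda)=\inf\{q(x)\mid x\in\Lambda\setminus\{0\}\}$. *)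

(* Defs.v *)
From HB Require Import structures.
From mathcomp Require Import all_boot all_order all_algebra.
From mathcomp Require Import complex.
From mathcomp Require Import boolp classical_sets functions fsbigop.
From mathcomp Require Import reals constructive_ereal ereal.

Set Implicit Arguments.
Unset Strict Implicit.
Unset Printing Implicit Defensive.

Import Order.TTheory GRing.Theory Num.Theory.

Local Open Scope classical_set_scope.
Local Open Scope ring_scope.

Definition hilbert_lattice (R : realType) (L : zmodType) (q : L -> R) : Prop :=
  (forall x y, q (x + y) + q (x - y) = 2 * q x + 2 * q y) /\
  (exists2 r : R, 0 < r & forall x, x != 0 -> r <= q x).

(* The infimum is taken in the extended reals, hence is +oo for the zero
   lattice. *)
Definition lattice_min (R : realType) (L : zmodType) (q : L -> R) : \bar R :=
  ereal_inf [set (q x)%:E | x in [set x | x != 0]].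

Definition is_algebraic_closure (F : fieldType) (E : closedFieldType)
    (iota : {rmorphism F -> E}) : Prop :=
  forall x : E, algebraicOver iota x.

Section AlgebraicIntegers.
Variable L : fieldType.

Definition algebraic_integer : {pred L} :=
  fun x => `[< integralOver (intr : int -> L) x >].

Lemma algebraic_integer_subring_closed : subring_closed algebraic_integer.
Proof.
split=> [|x y /asboolP ix /asboolP iy|x y /asboolP ix /asboolP iy];
  apply/asboolP.
- exact: integral1.
- exact: integral_sub.
- exact: integral_mul.
Qed.

HB.instance Definition _ :=
  GRing.isSubringClosed.Build L algebraic_integer
    algebraic_integer_subring_closed.

Record Zbar := MkZbar { Zbar_val :> L; _ : Zbar_val \in algebraic_integer }.

HB.instance Definition _ := [isSub for Zbar_val].
HB.instance Definition _ := [Choice of Zbar by <:].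
HB.instance Definition _ := [SubChoice_isSubComNzRing of Zbar by <:].

End AlgebraicIntegers.

Section SimpleExtension.
Variables (L : fieldType) (a : L).

(* The smallest subfield of L containing a. *)
Definition in_Qadjoin : {pred L} :=
  fun x => `[< forall S : divringClosed L, a \in S -> x \in S >].

Lemma in_Qadjoin_divring_closed : divring_closed in_Qadjoin.
Proof.
split=> [|x y /asboolP Qx /asboolP Qy|x y /asboolP Qx /asboolP Qy];
  apply/asboolP => S aS.
- exact: rpred1.
- by rewrite rpredB ?Qx ?Qy.
- by rewrite rpred_div ?Qx ?Qy.
Qed.

HB.instance Definition _ :=
  GRing.isDivringClosed.Build L in_Qadjoin in_Qadjoin_divring_closed.

Record Qadjoin := MkQadjoin { Qadjoin_val :> L; _ : Qadjoin_val \in in_Qadjoin }.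

HB.instance Definition _ := [isSub for Qadjoin_val].
HB.instance Definition _ := [Choice of Qadjoin by <:].
HB.instance Definition _ := [SubChoice_isSubIntegralDomain of Qadjoin by <:].
HB.instance Definition _ := [SubIntegralDomain_isSubField of Qadjoin by <:].

Lemma Qadjoin_gen_subproof : a \in in_Qadjoin.
Proof. by apply/asboolP. Qed.

Definition Qadjoin_gen : Qadjoin := MkQadjoin Qadjoin_gen_subproof.

End SimpleExtension.

Definition is_Qbasis (K : fieldType) (n : nat) (b : 'I_n -> K) : Prop :=
  forall x : K, exists! c : 'rV[rat]_n, x = \sum_(i < n) ratr (c 0 i) * b i.

(* [K : Q] for K of characteristic zero, with the junk value 0 when K is not
   finite-dimensional over Q. *)
Definition Qdegree (K : fieldType) : nat :=
  xget 0%N [set n : nat | exists b : 'I_n -> K, is_Qbasis b].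

Definition complex_embeddings (R : realType) (K : fieldType) : set (K -> R[i]) :=
  [set s : K -> R[i] | zmod_morphism s /\ monoid_morphism s].
Arguments complex_embeddings : clear implicits.

(* A field embedding of a number field is determined by the image of a
   generator, so that the sum below is finite for algebraic a. *)
Definition sqnorm (R : realType) (L : fieldType) (a : L) : R :=
  (Qdegree (Qadjoin a))%:R^-1 *
  \sum_(s \in complex_embeddings R (Qadjoin a))
    Normc.normc (s (Qadjoin_gen a)) ^+ 2.

(* Main.v *)
From HB Require Import structures.
Require Import Defs.
From mathcomp Require Import all_boot all_order all_algebra all_field.
From mathcomp Require Import complex polyorder.
From mathcomp Require Import ring.
From mathcomp Require Import boolp classical_sets fsbigop.
From mathcomp Require Import reals constructive_ereal ereal.

(** Everything is read off minimal polynomials over Q. Let a be algebraic with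
    minimal polynomial p of degree n. Then 1, a, ..., a^(n-1) is a basis of
    Q(a), and an embedding of Q(a) in C amounts to the choice of a root of p,
    so q(a) is the mean of |z|^2 over the n distinct complex roots z of p
    ([sqnormE]).

    The parallelogram identity compares four elements x, y, x + y, x - y that
    may generate different fields, so these means have to be taken over a common
    index set. By the primitive element theorem x and y are polynomials in a
    single t. If f is a rational polynomial, evaluation at f maps the conjugates
    of t onto the conjugates of f(t), and all the fibers of this map have the
    same number of elements ([fiber_card]); hence q(f(t)) is also the mean of
    |f(z)|^2 over the conjugates z of t ([sqnorm_horner]). The identity for q is
    then the mean of the identities for the complex absolute value.

    For an algebraic integer x other than 0 the product of the conjugates is,
    up to sign, the constant coefficient of a monic irreducible integral
    polynomial, a nonzero integer. The arithmetic-geometric mean inequality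
    gives q(x) >= 1 ([sqnorm_ge1]), and the bound is attained at 1. *)

Import Order.TTheory GRing.Theory Num.Theory.
Local Open Scope ring_scope.

Set Implicit Arguments.
Unset Strict Implicit.
Unset Printing Implicit Defensive.

Local Notation "p ^ f" := (map_poly f p) : ring_scope.

(** * Minimal polynomials *)

(** The second clause makes the polynomials over F that vanish at a exactly the
    ideal generated by p, which is the form in which minimality is used. *)
Definition minimal_polynomial (F L : fieldType) (iota : {rmorphism F -> L})
    (a : L) (p : {poly F}) : Prop :=
  p \is monic /\ forall q, root (q ^ iota) a = (p %| q).

Section MinimalPolynomial.
Variables (F L : fieldType) (iota : {rmorphism F -> L}) (a : L) (p : {poly F}).
Hypothesis pP : minimal_polynomial iota a p.

Let p_monic : p \is monic. Proof. by case: pP. Qed.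
Let p_neq0 : p != 0. Proof. exact: monic_neq0. Qed.

Lemma minimal_polynomial_root : root (p ^ iota) a.
Proof. by case: pP => _ ->. Qed.

Lemma size_minimal_polynomial : (1 < size p)%N.
Proof.
rewrite -(size_map_poly iota).
by apply: root_size_gt1 minimal_polynomial_root; rewrite map_poly_eq0.
Qed.

(** Factoring p = q r and evaluating at a shows that a is a root of q or of
    r, hence that p divides one of them; for degree reasons p | r would make q
    constant. *)
Lemma minimal_polynomial_irreducible : irreducible_poly p.
Proof.
split=> [|q q_neq1]; first exact: size_minimal_polynomial.
case: pP => _ rootE /dvdpP[r def_p].
have := minimal_polynomial_root; rewrite def_p rmorphM rootM !rootE.
case/orP=> [p_dvd_r | p_dvd_q]; last first.
  by rewrite /eqp -def_p p_dvd_q def_p dvdp_mull.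
have r_neq0 : r != 0 by apply: contraNneq p_neq0 => r0; rewrite def_p r0 mul0r.
have q_neq0 : q != 0 by apply: contraNneq p_neq0 => q0; rewrite def_p q0 mulr0.
have := dvdp_leq r_neq0 p_dvd_r; rewrite def_p size_mul //.
have := size_poly_gt0 q; rewrite q_neq0; move: q_neq1; rewrite neq_ltn.
case: (size q) => [|[|n]] //= _ _.
by rewrite addnS /= addnS -ltnS ltnNge ltnS leq_addr.
Qed.
End MinimalPolynomial.

(** The monic irreducible p with root a has this property: if a is a root
    of q, it is one of gcd(p, q), which is therefore not constant and so is
    associated to p. *)
Lemma minimal_polynomial_exists (F : fieldType) (L : closedFieldType)
    (iota : {rmorphism F -> L}) (a : L) :
  algebraicOver iota a -> exists p, minimal_polynomial iota a p.
Proof.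
move=> /integral_algebraic a_int.
have dec : decidable_embedding iota by move=> y; apply: pselect.
have [p [p_monic pa0 p_irr]] := minPoly_decidable_closure dec a_int.
exists p; split=> // q; apply/idP/idP=> [qa0 | /dvdpP[r ->]]; last first.
  by rewrite rmorphM rootM pa0 orbT.
suffices /eqp_dvdl <- : gcdp p q %= p by apply: dvdp_gcdr.
rewrite p_irr ?dvdp_gcdl ?gtn_eqF // -(size_map_poly iota) gcdp_map.
apply: (@root_size_gt1 _ a); rewrite ?root_gcd ?pa0 //.
by rewrite gcdp_eq0 negb_and map_poly_eq0 monic_neq0.
Qed.

(** In characteristic zero the derivative of p is nonzero of smaller degree,
    hence prime to the irreducible p, and p has no repeated root. *)
Lemma minimal_polynomial_split (L : fieldType) (iota : {rmorphism rat -> L})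
    (a : L) (p : {poly rat}) (C : closedFieldType)
    (kappa : {rmorphism rat -> C}) :
  minimal_polynomial iota a p ->
  exists2 rs : seq C, uniq rs & p ^ kappa = \prod_(z <- rs) ('X - z%:P).
Proof.
move=> pP; have [p_monic _] := pP.
have [rs def_p] := closed_field_poly_normal (p ^ kappa).
have {}def_p : p ^ kappa = \prod_(z <- rs) ('X - z%:P).
  have /eqP lead1 : lead_coef (p ^ kappa) == 1 by rewrite -monicE map_monic.
  by rewrite {1}def_p lead1 scale1r.
exists rs => //; rewrite -separable_prod_XsubC -def_p separable_map.
have [p_gt1 p_irr] := minimal_polynomial_irreducible pP.
rewrite unlock /coprimep; apply: contraT => /p_irr/(_ (dvdp_gcdl _ _)).
case/andP=> _ /dvdp_trans/(_ (dvdp_gcdr _ _)) /dvdp_leq.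
rewrite -size_poly_gt0 size_deriv -subn1 subn_gt0 p_gt1 => /(_ isT).
by rewrite leqNgt subn1 ltn_predL (ltn_trans _ p_gt1).
Qed.

(** * The field Q(a) and its degree *)

Section SimpleExtension.
Variables (L : fieldType) (iota : {rmorphism rat -> L}) (a : L).

Fact Qadjoin_rat_subproof r : iota r \in in_Qadjoin a.
Proof. by rewrite fmorph_eq_rat rpred_rat. Qed.

Definition Qadjoin_rat r : Qadjoin a := MkQadjoin (Qadjoin_rat_subproof r).

Fact Qadjoin_rat_zmod_morphism : zmod_morphism Qadjoin_rat.
Proof. by move=> r s; apply/val_inj/rmorphB. Qed.
Fact Qadjoin_rat_monoid_morphism : monoid_morphism Qadjoin_rat.
Proof. by split=> [|r s]; apply/val_inj; [apply: rmorph1 | apply: rmorphM]. Qed.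
HB.instance Definition _ :=
  GRing.isZmodMorphism.Build rat (Qadjoin a) Qadjoin_rat
    Qadjoin_rat_zmod_morphism.
HB.instance Definition _ :=
  GRing.isMonoidMorphism.Build rat (Qadjoin a) Qadjoin_rat
    Qadjoin_rat_monoid_morphism.

Lemma ratr_Qadjoin r : ratr r = Qadjoin_rat r.
Proof. by rewrite fmorph_eq_rat. Qed.

Lemma val_horner_Qadjoin (f : {poly rat}) :
  val (f ^ Qadjoin_rat).[Qadjoin_gen a] = (f ^ iota).[a].
Proof. by rewrite -horner_map -map_poly_comp. Qed.

Variable p : {poly rat}.
Hypothesis pP : minimal_polynomial iota a p.

Let rootE q : root (q ^ iota) a = (p %| q). Proof. by case: pP. Qed.

Let in_Qpoly : {pred L} :=
  fun x => `[< exists f : {poly rat}, x = (f ^ iota).[a] >].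

(** If f(a) is nonzero then f is prime to the irreducible p, and a Bezout
    relation u f + v p = 1 evaluates at a to u(a) = 1 / f(a). *)
Lemma horner_divring_closed : divring_closed in_Qpoly.
Proof.
split=> [|_ _ /asboolP[f ->] /asboolP[g ->]|_ _ /asboolP[f ->] /asboolP[g ->]].
- by apply/asboolP; exists 1; rewrite rmorph1 hornerC.
- by apply/asboolP; exists (f - g); rewrite rmorphB hornerD hornerN.
apply/asboolP; have [ga0 | ga_neq0] := eqVneq (g ^ iota).[a] 0.
  by exists 0; rewrite ga0 invr0 mulr0 rmorph0 horner0.
have : coprimep g p.
  rewrite coprimep_sym /coprimep; apply: contraT => d_neq1.
  have [_ p_irr] := minimal_polynomial_irreducible pP.
  have /andP[_ p_dvd] := p_irr _ d_neq1 (dvdp_gcdl _ _).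
  have := dvdp_trans p_dvd (dvdp_gcdr _ _).
  by rewrite -rootE /root (negPf ga_neq0).
case/Bezout_eq1_coprimepP=> -[u v] /= bezout; exists (f * u).
rewrite rmorphM hornerM; congr (_ * _); apply/(mulIf ga_neq0).
rewrite mulVf // -hornerM -rmorphM.
have := congr1 (fun q => (q ^ iota).[a]) bezout.
rewrite rmorphD !rmorphM rmorph1 !hornerE.
have /rootP-> : root (p ^ iota) a by rewrite rootE.
by rewrite mulr0 addr0 => ->.
Qed.

(** The polynomial values at a form a field containing a, so by minimality they
    exhaust Q(a). *)
Lemma in_QadjoinE (x : Qadjoin a) :
  exists f : {poly rat}, x = (f ^ Qadjoin_rat).[Qadjoin_gen a].
Proof.
pose S : divringClosed L :=
  HB.pack in_Qpoly (GRing.isDivringClosed.Build L _ horner_divring_closed).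
have /asboolP/(_ S) : val x \in in_Qadjoin a by apply: valP.
case/(_ _)/asboolP=> [|f def_x].
  by apply/asboolP; exists 'X; rewrite map_polyX hornerX.
by exists f; apply/val_inj; rewrite val_horner_Qadjoin.
Qed.

Lemma Qadjoin_horner_eq (f g : {poly rat}) :
  (f ^ Qadjoin_rat).[Qadjoin_gen a] = (g ^ Qadjoin_rat).[Qadjoin_gen a] ->
  p %| f - g.
Proof.
move/(congr1 val); rewrite !val_horner_Qadjoin -rootE rmorphB /= => eq_fg.
by rewrite /root hornerD hornerN eq_fg subrr.
Qed.

Lemma Qadjoin_Qbasis :
  is_Qbasis (fun i : 'I_(size p).-1 => Qadjoin_gen a ^+ i).
Proof.
have comb (c : 'rV[rat]_(size p).-1) :
    \sum_i ratr (c 0 i) * Qadjoin_gen a ^+ i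
      = (rVpoly c ^ Qadjoin_rat).[Qadjoin_gen a].
  rewrite [rVpoly c]poly_def rmorph_sum horner_sum; apply: eq_bigr => i _.
  by rewrite valK /= map_polyZ map_polyXn hornerZ hornerXn ratr_Qadjoin.
have p_gt1 := size_minimal_polynomial pP.
have p_neq0 : p != 0 by apply/monic_neq0; case: pP.
move=> x; have [f def_x] := in_QadjoinE x.
have size_mod : (size (f %% p)%R <= (size p).-1)%N.
  by rewrite -ltnS prednK ?ltn_modp // (ltn_trans _ p_gt1).
exists (poly_rV (f %% p)); split.
  rewrite comb poly_rV_K // def_x {1}(divp_eq f p) rmorphD rmorphM /= hornerD.
  rewrite hornerM; suff -> : (p ^ Qadjoin_rat).[Qadjoin_gen a] = 0.
    by rewrite mulr0 add0r.
  apply/val_inj; rewrite val_horner_Qadjoin.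
  by apply/rootP; apply: minimal_polynomial_root pP.
move=> c; rewrite comb def_x => /Qadjoin_horner_eq p_dvd.
rewrite -[RHS]rVpolyK; congr poly_rV; apply/eqP; rewrite -subr_eq0.
have : p %| f %% p - rVpoly c.
  by rewrite /dvdp modpD modpN modp_id -modpN -modpD.
apply: contraTT => d_neq0; apply/negP=> /(dvdp_leq d_neq0); apply/negP.
rewrite -ltnNge -[X in (_ < X)%N](ltn_predK p_gt1) ltnS.
rewrite (leq_trans (size_polyD _ _)) //.
by rewrite geq_max size_mod size_polyN size_poly.
Qed.

End SimpleExtension.

(** Writing each of two bases in terms of the other gives matrices u and v with
    u v = 1, by uniqueness of coordinates in the first. *)
Lemma is_Qbasis_leq (K : fieldType) (kappa : {rmorphism rat -> K})
    (m n : nat) (b : 'I_m -> K) (c : 'I_n -> K) :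
  is_Qbasis b -> is_Qbasis c -> (m <= n)%N.
Proof.
have ratrE : ratr =1 kappa by move=> r; rewrite fmorph_eq_rat.
move=> b_basis c_basis.
have /choice[u def_b] : forall i, exists v : 'rV[rat]_n,
    b i = \sum_j kappa (v 0 j) * c j.
  move=> i; have [v [def_v _]] := c_basis (b i); exists v.
  by rewrite {1}def_v; apply: eq_bigr => j _; rewrite ratrE.
have /choice[v def_c] : forall j, exists v : 'rV[rat]_m,
    c j = \sum_i kappa (v 0 i) * b i.
  move=> j; have [v [def_v _]] := b_basis (c j); exists v.
  by rewrite {1}def_v; apply: eq_bigr => i _; rewrite ratrE.
apply: (@mulmx1_min _ _ _ (\matrix_(i, j) u i 0 j) (\matrix_(j, k) v j 0 k)).
apply/row_matrixP => i.
have [w [_ w_unique]] := b_basis (b i).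
rewrite -(w_unique (row i 1%:M)); last first.
  rewrite (bigD1 i) //= big1 => [|k k_neq_i]; rewrite !mxE ?eqxx ratrE.
    by rewrite rmorph1 mul1r addr0.
  by rewrite eq_sym (negPf k_neq_i) rmorph0 mul0r.
symmetry; apply: w_unique; rewrite def_b.
under eq_bigr => j _ do rewrite def_c mulr_sumr.
rewrite exchange_big; apply: eq_bigr => k _ /=.
rewrite !mxE ratrE rmorph_sum mulr_suml; apply: eq_bigr => j _.
by rewrite !mxE rmorphM mulrA.
Qed.

Lemma QdegreeE (K : fieldType) (kappa : {rmorphism rat -> K}) (n : nat)
    (b : 'I_n -> K) :
  is_Qbasis b -> Qdegree K = n.
Proof.
move=> b_basis; apply: xget_unique => [|m [c c_basis]]; first by exists b.
apply/eqP; rewrite eqn_leq; apply/andP; split.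
  exact: (is_Qbasis_leq kappa c_basis b_basis).
exact: (is_Qbasis_leq kappa b_basis c_basis).
Qed.

(** * Embeddings of Q(a) *)

Section Embeddings.
Variables (L : fieldType) (iota : {rmorphism rat -> L}) (a : L).
Variables (p : {poly rat}) (C : fieldType) (kappa : {rmorphism rat -> C}).
Hypothesis pP : minimal_polynomial iota a p.

Lemma embedding_horner (s : {rmorphism Qadjoin a -> C}) (f : {poly rat}) :
  s (f ^ Qadjoin_rat iota a).[Qadjoin_gen a] = (f ^ kappa).[s (Qadjoin_gen a)].
Proof.
rewrite -horner_map -map_poly_comp; congr (_.[_]); apply: eq_map_poly => r /=.
by rewrite -ratr_Qadjoin fmorph_rat fmorph_eq_rat.
Qed.

Lemma embedding_inj (s t : {rmorphism Qadjoin a -> C}) :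
  s (Qadjoin_gen a) = t (Qadjoin_gen a) -> s =1 t.
Proof.
move=> eq_st x; have [f ->] := in_QadjoinE pP x.
by rewrite !embedding_horner eq_st.
Qed.

Lemma embedding_root (s : {rmorphism Qadjoin a -> C}) :
  root (p ^ kappa) (s (Qadjoin_gen a)).
Proof.
rewrite /root -embedding_horner fmorph_eq0 -(inj_eq val_inj) val_horner_Qadjoin.
exact: minimal_polynomial_root pP.
Qed.

(** The value at f(a) is forced to be f(z); it does not depend on f because
    p, which divides the difference of any two choices, vanishes at z. *)
Lemma embedding_exists (z : C) :
  root (p ^ kappa) z ->
  exists s : {rmorphism Qadjoin a -> C}, s (Qadjoin_gen a) = z.
Proof.
move=> pz0; have /choice[f def_f] := in_QadjoinE pP.
pose s x := (f x ^ kappa).[z].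
have sE g : s (g ^ Qadjoin_rat iota a).[Qadjoin_gen a] = (g ^ kappa).[z].
  apply/eqP; rewrite -subr_eq0 -hornerN -hornerD -rmorphB.
  by apply: (root_dvdp _ pz0); rewrite dvdp_map (Qadjoin_horner_eq pP) -?def_f.
have s_zmod : zmod_morphism s.
  move=> x y; rewrite [x in LHS]def_f [y in LHS]def_f -hornerN -hornerD -rmorphB.
  by rewrite sE rmorphB hornerD hornerN.
have s_monoid : monoid_morphism s.
  split=> [|x y].
    have -> : 1 = ((1 : {poly rat}) ^ Qadjoin_rat iota a).[Qadjoin_gen a].
      by rewrite rmorph1 hornerC.
    by rewrite sE rmorph1 hornerC.
  rewrite [x in LHS]def_f [y in LHS]def_f -hornerM -rmorphM.
  by rewrite sE rmorphM hornerM.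
pose S : {rmorphism Qadjoin a -> C} :=
  HB.pack s (GRing.isZmodMorphism.Build _ _ _ s_zmod)
    (GRing.isMonoidMorphism.Build _ _ _ s_monoid).
exists S => /=.
rewrite -{1}(hornerX (Qadjoin_gen a)) -(map_polyX (Qadjoin_rat iota a)) sE.
by rewrite map_polyX hornerX.
Qed.
End Embeddings.

(** * The square-norm as a mean over conjugates *)

(** The linear factors X - z with h(z) nonzero are prime to h, so they contribute
    nothing to the gcd. *)
Lemma gcdp_prod_XsubC (C : fieldType) (rs : seq C) (h : {poly C}) :
  uniq rs ->
  gcdp (\prod_(z <- rs) ('X - z%:P)) h %=
    \prod_(z <- [seq z <- rs | root h z]) ('X - z%:P).
Proof.
move=> rs_uniq; apply/andP; split; last first.
  rewrite dvdp_gcd; apply/andP; split; apply: uniq_roots_dvdp;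
    rewrite ?uniq_rootsE ?filter_uniq //; apply/allP=> z;
    rewrite mem_filter ?root_prod_XsubC => /andP[] //.
set g := gcdp _ h; have : g %| \prod_(z <- rs) ('X - z%:P) by apply: dvdp_gcdl.
rewrite (bigID (fun z => root h z)) /= big_filter Gauss_dvdpl //.
apply: (big_ind (fun q => coprimep g q)) => [|q r gq gr|z hz_neq0].
- exact: coprimep1.
- by rewrite coprimepMr gq.
by rewrite coprimep_XsubC; apply: contra hz_neq0; rewrite root_gcd => /andP[].
Qed.

(** The conjugates of t mapped by f to a conjugate w of f(t) are the roots of
    gcd(p, f - w). This is the image under Q(f(t)) -> C, f(t) |-> w, of the gcd
    of p and f - f(t) over Q(f(t)), so its degree is the same for every w. *)
Lemma fiber_card (L : fieldType) (iota : {rmorphism rat -> L}) (t : L)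
    (f p m : {poly rat}) (C : fieldType) (kappa : {rmorphism rat -> C})
    (rs ws : seq C) :
    minimal_polynomial iota (f ^ iota).[t] m ->
    uniq rs -> p ^ kappa = \prod_(z <- rs) ('X - z%:P) ->
    m ^ kappa = \prod_(w <- ws) ('X - w%:P) ->
  exists d, forall w, w \in ws ->
    count (fun z => (f ^ kappa).[z] == w) rs = d.
Proof.
set a := (f ^ iota).[t] => mP rs_uniq def_p def_m.
pose j := Qadjoin_rat iota a.
exists (size (gcdp (p ^ j) (f ^ j - (Qadjoin_gen a)%:P))).-1 => w w_ws.
have /(embedding_exists mP)[s def_w] : root (m ^ kappa) w.
  by rewrite def_m root_prod_XsubC.
have sj : s \o j =1 kappa.
  by move=> r; rewrite /= /j -ratr_Qadjoin fmorph_rat fmorph_eq_rat.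
rewrite -(size_map_poly s) gcdp_map rmorphB /= map_polyC /= def_w.
rewrite -!map_poly_comp !(eq_map_poly sj) def_p.
rewrite (eqp_size (gcdp_prod_XsubC _ rs_uniq)) size_prod_XsubC /= size_filter.
by apply: eq_count => z; rewrite /root hornerD hornerN hornerC subr_eq0.
Qed.

Section SquareNorm.
Variables (R : realType) (L : fieldType) (iota : {rmorphism rat -> L}).

(** The map s |-> s(a) is a bijection from the embeddings of Q(a) onto the roots
    of p ([embedding_inj], [embedding_exists]), and [Q(a) : Q] = deg p. *)
Lemma sqnormE (a : L) (p : {poly rat}) (rs : seq R[i]) :
    minimal_polynomial iota a p -> uniq rs ->
    p ^ ratr = \prod_(z <- rs) ('X - z%:P) ->
  sqnorm R a = (size rs)%:R^-1 * \sum_(z <- rs) Normc.normc z ^+ 2.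
Proof.
move=> pP rs_uniq def_p; rewrite /sqnorm.
have root_rs z : root (p ^ ratr) z = (z \in rs).
  by rewrite def_p root_prod_XsubC.
congr (_^-1 * _).
  rewrite (QdegreeE (Qadjoin_rat iota a) (Qadjoin_Qbasis pP)).
  by rewrite -(size_map_poly (ratr : rat -> R[i])) def_p size_prod_XsubC.
rewrite [RHS]fsbig_seq //.
symmetry; apply: (@reindex_fsbig _ _ _ _ _
  (fun s : Qadjoin a -> R[i] => s (Qadjoin_gen a)) _ _
  (fun z => Normc.normc z ^+ 2)).
(* The lemmas on embeddings take bundled morphisms. *)
pose pack s (sP : complex_embeddings R (Qadjoin a) s) :
    {rmorphism Qadjoin a -> R[i]} :=
  HB.pack s (GRing.isZmodMorphism.Build _ _ s sP.1)
    (GRing.isMonoidMorphism.Build _ _ s sP.2).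
split.
- by move=> s sP /=; rewrite -root_rs; apply: (embedding_root _ pP (pack s sP)).
- move=> s t /set_mem sP /set_mem tP eq_st; apply/funext.
  exact: (embedding_inj ratr pP (s := pack s sP) (t := pack t tP)).
move=> z /=; rewrite -root_rs => /(embedding_exists pP)[s def_z].
exists s => //; split; first exact: rmorphB.
by split; [apply: rmorph1 | apply: rmorphM].
Qed.

(** The conjugates of t are distributed evenly among the fibers over the
    conjugates of f(t), so averaging over the former or the latter is the same.
    The fibers over other points are empty, because p divides m o f. *)
Lemma sqnorm_horner (t : L) (f p m : {poly rat}) (rs : seq R[i]) :
    minimal_polynomial iota t p -> minimal_polynomial iota (f ^ iota).[t] m ->
    uniq rs -> p ^ ratr = \prod_(z <- rs) ('X - z%:P) ->
  sqnorm R (f ^ iota).[t] =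
    (size rs)%:R^-1 * \sum_(z <- rs) Normc.normc (f ^ ratr).[z] ^+ 2.
Proof.
move=> pP mP rs_uniq def_p.
have [ws ws_uniq def_m] := minimal_polynomial_split (ratr : rat -> R[i]) mP.
rewrite (sqnormE mP ws_uniq def_m).
have [d fiberE] := fiber_card mP rs_uniq def_p def_m.
have f_ws z : z \in rs -> (f ^ ratr).[z] \in ws.
  move=> z_rs; rewrite -root_prod_XsubC -def_m.
  have : root (p ^ ratr) z by rewrite def_p root_prod_XsubC.
  have : p %| m \Po f.
    have [_ <-] := pP; rewrite map_comp_poly /root horner_comp.
    exact: minimal_polynomial_root mP.
  rewrite -(dvdp_map (ratr : rat -> R[i])) => /root_dvdp /[apply].
  by rewrite map_comp_poly /root horner_comp.
have sum_fibers (V : nmodType) (F : R[i] -> V) :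
    \sum_(z <- rs) F (f ^ ratr).[z] = \sum_(w <- ws) F w *+ d.
  transitivity (\sum_(z <- rs) \sum_(w <- ws | (f ^ ratr).[z] == w) F w).
    apply: eq_big_seq => z z_rs.
    rewrite (eq_bigl (xpred1 (f ^ ratr).[z])) => [|w]; last exact: eq_sym.
    by rewrite -big_filter filter_pred1_uniq ?f_ws // big_seq1.
  rewrite (exchange_big_dep xpredT) //=; apply: eq_big_seq => w w_ws.
  by rewrite big_const_seq (fiberE w w_ws) iter_addr addr0.
have size_rs : size rs = (size ws * d)%N.
  (* Counting is the case of the constant function 1. *)
  have := sum_fibers nat (fun=> 1).
  rewrite !big_const_seq !count_predT !iter_addr !addr0 -mulrnA !natn.
  by rewrite mulnC.
have d_neq0 : d%:R != 0 :> R.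
  rewrite pnatr_eq0; apply: contraTneq (size_minimal_polynomial pP) => d0.
  rewrite -(size_map_poly (ratr : rat -> R[i])) def_p size_prod_XsubC size_rs.
  by rewrite d0 muln0.
rewrite (sum_fibers _ (fun w => Normc.normc w ^+ 2)) sumrMnl -[_ *+ d]mulr_natr.
by rewrite size_rs natrM invfM -mulrA [_ * d%:R]mulrC mulKf.
Qed.
End SquareNorm.

(** * The complex absolute value *)

Section ComplexAbsoluteValue.
Variable R : rcfType.

Lemma normc_parallelogram (u v : R[i]) :
  Normc.normc (u + v) ^+ 2 + Normc.normc (u - v) ^+ 2 =
    2 * Normc.normc u ^+ 2 + 2 * Normc.normc v ^+ 2.
Proof.
case: u v => [a b] [c d]; rewrite /Normc.normc /= !sqr_sqrtr;
  rewrite ?addr_ge0 ?sqr_ge0 //.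
ring.
Qed.

Lemma normc_int (k : int) : Normc.normc (k%:~R : R[i]) ^+ 2 = k%:~R ^+ 2.
Proof.
by rewrite -(rmorph_int (real_complex R)) /= expr0n addr0 sqr_sqrtr ?sqr_ge0.
Qed.
End ComplexAbsoluteValue.

(** * The Hilbert lattice of algebraic integers *)

Section AlgebraicClosure.
Variables (R : realType) (Qbar : closedFieldType).
Variable iota : {rmorphism rat -> Qbar}.
Hypothesis Qbar_closure : is_algebraic_closure iota.

(** With x = u(t) and y = v(t), the four square-norms are means over the
    conjugates of t, and the identity holds term by term. *)
Lemma sqnorm_parallelogram (x y : Qbar) :
  sqnorm R (x + y) + sqnorm R (x - y) = 2 * sqnorm R x + 2 * sqnorm R y.
Proof.
have [f f_neq0 fx0] := Qbar_closure x; have [g g_neq0 gy0] := Qbar_closure y.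
have [n /= [[u def_x] [v def_y]]] :=
  pchar0_PET f_neq0 fx0 g_neq0 gy0 (@pchar_num _).
set t := y *+ n - x in def_x def_y.
have [p pP] := minimal_polynomial_exists (Qbar_closure t).
have [rs rs_uniq def_p] := minimal_polynomial_split (ratr : rat -> R[i]) pP.
have sqnorm_t (h : {poly rat}) : sqnorm R (h ^ iota).[t] =
    (size rs)%:R^-1 * \sum_(z <- rs) Normc.normc (h ^ ratr).[z] ^+ 2.
  have [m mP] := minimal_polynomial_exists (Qbar_closure (h ^ iota).[t]).
  exact: sqnorm_horner pP mP rs_uniq def_p.
rewrite -def_x -def_y -hornerN -!hornerD -rmorphB -rmorphD !sqnorm_t.
rewrite -mulrDr -big_split ![2 * (_ * _)]mulrCA -mulrDr.
congr (_ * _); rewrite !mulr_sumr -big_split /=; apply: eq_bigr => z _ /=.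
by rewrite rmorphB rmorphD !hornerD hornerN; apply: normc_parallelogram.
Qed.

(** Arithmetic-geometric mean: the product of the conjugates of x is up to sign
    the constant coefficient of its minimal polynomial, a nonzero integer by
    Gauss's lemma. *)
Lemma sqnorm_ge1 (x : Qbar) :
  x \in @algebraic_integer Qbar -> x != 0 -> 1 <= sqnorm R x.
Proof.
move=> /asboolP[q q_monic qx0] x_neq0.
have [p pP] := minimal_polynomial_exists (Qbar_closure x).
have [p_monic rootE] := pP.
have [rs rs_uniq def_p] := minimal_polynomial_split (ratr : rat -> R[i]) pP.
have [k def_p0] : exists k : int, p.[0] = k%:~R.
  have : p %| map_poly intr q.
    rewrite -rootE -map_poly_comp; move: qx0; congr (root _ _).
    by apply: eq_map_poly => r /=; rewrite rmorph_int.
  (* p is a rational multiple c p1 of an integral divisor p1 of the monic q. As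
     q = p1 r is monic and p is monic, c is the leading coefficient of r. *)
  case/dvdpP_rat_int=> p1 [c _ def_p1] [r def_q].
  exists (lead_coef r * p1.[0]); rewrite def_p1 hornerZ.
  rewrite -(rmorph0 (intr : int -> rat)) horner_map rmorphM /=; congr (_ * _).
  move: p_monic; rewrite monicE def_p1 lead_coefZ.
  rewrite lead_coef_map_inj //; last exact: intr_inj.
  move/eqP=> c_lead; move: q_monic; rewrite monicE def_q lead_coefM.
  move/eqP/(congr1 (intr : int -> rat)); rewrite rmorphM rmorph1 => r_lead.
  by rewrite -[LHS]mulr1 -[X in _ * X = _]r_lead mulrA c_lead mul1r.
have k_neq0 : k != 0.
  (* Otherwise the irreducible p is associated to X, which forces x = 0. *)
  have [_ p_irr] := minimal_polynomial_irreducible pP.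
  apply: contraNneq x_neq0 => k0; move: def_p0; rewrite k0 => /eqP p00.
  have : 'X %= p by apply: p_irr; rewrite ?size_polyX // -['X]subr0 dvdp_XsubCl.
  by case/andP=> _; rewrite -rootE map_polyX /root hornerX.
have prod_conj : \prod_(z <- rs) Normc.normc z ^+ 2 = k%:~R ^+ 2 :> R.
  rewrite prodrXl -normc_int -(ratr_int _ k) -def_p0; congr (_ ^+ 2).
  rewrite -horner_map rmorph0 /= def_p horner_prod.
  rewrite (big_morph _ (@Normc.normcM R) (@Normc.normc1 R)).
  apply: eq_bigr => z _; rewrite !hornerE.
  by case: (z) => u v; rewrite /= !sqrrN.
have size_rs : (0 < size rs)%N.
  have := size_minimal_polynomial pP.
  by rewrite -(size_map_poly (ratr : rat -> R[i])) def_p size_prod_XsubC.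
rewrite (sqnormE pP rs_uniq def_p) mulrC.
set mean := (X in 1 <= X).
have agm : \prod_(z <- rs) Normc.normc z ^+ 2 <= mean ^+ size rs.
  have := leif_AGM (A := xpredT)
    (E := fun i => Normc.normc (tnth (in_tuple rs) i) ^+ 2).
  rewrite -!(big_tnth _ _ _ xpredT (fun z => Normc.normc z ^+ 2)).
  by rewrite cardT size_enum_ord => -[|//] i _; apply: sqr_ge0.
rewrite leNgt; apply/negP=> mean_lt1.
have mean_ge0 : 0 <= mean.
  by rewrite divr_ge0 // sumr_ge0 // => z _; apply: sqr_ge0.
have mean_exp_lt1 : mean ^+ size rs < 1 by rewrite exprn_ilt1 // -lt0n.
have := le_lt_trans agm mean_exp_lt1; rewrite prod_conj -rmorphXn /=.
rewrite -(rmorph1 (intr : int -> R)) ltr_int ltNge -gtz0_ge1.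
by rewrite exprn_even_gt0 ?k_neq0.
Qed.

Lemma sqnorm1 : sqnorm R (1 : Qbar) = 1.
Proof.
have pP : minimal_polynomial iota 1 ('X - 1%:P).
  split=> [|q]; first exact: monicXsubC.
  by rewrite -(rmorph1 iota) fmorph_root dvdp_XsubCl.
have def_p : ('X - 1%:P) ^ ratr = \prod_(z <- [:: 1]) ('X - z%:P) :> {poly R[i]}.
  by rewrite big_seq1 rmorphB /= map_polyX map_polyC /= rmorph1.
by rewrite (sqnormE pP _ def_p) //= big_seq1 Normc.normc1 expr1n mulr1 invr1.
Qed.
End AlgebraicClosure.

Theorem theorem7p9 (R : realType) (Qbar : closedFieldType)
    (iota : {rmorphism rat -> Qbar}) (Qbar_closure : is_algebraic_closure iota) :
  hilbert_lattice (fun x : Zbar Qbar => sqnorm R (Zbar_val x)) /\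
  lattice_min (fun x : Zbar Qbar => sqnorm R (Zbar_val x)) = 1%:E.
Proof.
have ge1 (x : Zbar Qbar) : x != 0 -> 1 <= sqnorm R (Zbar_val x).
  by move=> x_neq0; apply: (sqnorm_ge1 R Qbar_closure) => //; apply: valP.
split; first split=> [x y|]; first exact: sqnorm_parallelogram.
  by exists 1.
apply/eqP; rewrite eq_le; apply/andP; split.
  apply: ereal_inf_lbound; exists 1 => /=; first exact: oner_neq0.
  by rewrite (sqnorm1 R iota).
by apply: le_ereal_inf_tmp => _ [x /ge1 x_ge1 <-]; rewrite lee_fin.
Qed.
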